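(* Let $\Sigma$ be a set of two real $2\times2$ matrices that share at least one common eigenvector. Then $\Sigma$ has the oligo-vertex property, and $N_k(\Sigma)=O(k)$.
   Context: For a finite set $\Sigma$ of real $n\times n$ matrices, a vector $a\in\mathbb{R}^n$ and an integer $k\ge0$, let $P_k(\Sigma,a)=\mathrm{conv}\{T_{k-1}\cdots T_0a\mid T_j\in\Sigma,\ j=0,\ldots,k-1\}$ (convex hull), let $N_k(\Sigma,a)$ be the number of extreme points of $P_k(\Sigma,a)$, and let $N_k(\Sigma)=\sup_{a\in\mathbb{R}^n}N_k(\Sigma,a)$. The set $\Sigma$ has the oligo-vertex property if there exist $\alpha>0$, a positive integer $k_0$ and a positive constant $d$ such that $N_k(\Sigma)\le\alpha k^d$ for all $k\ge k_0$. Big-O notation is as $k\to\infty$. Eigenvectors are allowed to be complex. *)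

(* Defs.v *)
From HB Require Import structures.
From mathcomp Require Import all_boot all_order all_algebra.
From mathcomp Require Import finmap complex.
From mathcomp Require Import all_classical all_reals all_analysis.

Set Implicit Arguments.
Unset Strict Implicit.
Unset Printing Implicit Defensive.

Import Order.TTheory GRing.Theory Num.Theory.

Local Open Scope classical_set_scope.
Local Open Scope ring_scope.

Section ConvexGeometry.
Context {R : realType} {E : lmodType R}.

Definition conv_hull (A : set E) : set E :=
  smallest (@convex_set R E) A.

Definition extreme_points (C : set E) : set E :=
  [set x | C x /\ forall (y z : E) (t : R), C y -> C z -> 0 < t < 1 ->
     x = t *: y + (1 - t) *: z -> y = x /\ z = x].

End ConvexGeometry.

Section MatrixProducts.
Context {R : realType} {n : nat}.
Implicit Types (Sigma : {fset 'M[R]_n}) (a : 'cV[R]_n) (k : nat).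

(* [\prod] multiplies from left to right, so [rev_ord] makes the product
   T_(k-1) *m ... *m T_0. *)
Definition product_points k Sigma a : set 'cV[R]_n :=
  [set x | exists T : 'I_k -> 'M[R]_n,
     (forall j, T j \in Sigma) /\ x = (\prod_(j < k) T (rev_ord j)) *m a].

Definition P_ k Sigma a : set 'cV[R]_n := conv_hull (product_points k Sigma a).

Definition N_at k Sigma a : \bar R := counting (extreme_points (P_ k Sigma a)).

Definition N_ k Sigma : \bar R := ereal_sup [set N_at k Sigma a | a in setT].

Definition oligo_vertex Sigma : Prop :=
  exists (alpha : R) (k0 : nat) (d : R),
    [/\ 0 < alpha, (0 < k0)%N, 0 < d &
      forall k, (k0 <= k)%N -> (N_ k Sigma <= (alpha * k%:R `^ d)%:E)%E].

Definition is_eigenvector (A : 'M[R]_n) (v : 'cV[R[i]]_n) : Prop :=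
  v != 0 /\ exists lambda : R[i], map_mx (real_complex R) A *m v = lambda *: v.

Definition share_eigenvector Sigma : Prop :=
  exists v : 'cV[R[i]]_n, forall A, A \in Sigma -> is_eigenvector A v.

End MatrixProducts.

(* The library's [=O_] takes values in a normed module; this is the same
   notion for extended-real sequences, so in particular [f] is eventually
   finite. *)
Definition ebigO {R : realType} (f : nat -> \bar R) (g : nat -> R) : Prop :=
  exists C : R, \forall k \near \oo, (`|f k| <= (C * `|g k|)%:E)%E.

(* Main.v *)
Require Import Defs.
From mathcomp Require Import all_boot all_order all_algebra.
From mathcomp Require Import finmap.
From mathcomp Require Import all_classical all_reals all_analysis.
From mathcomp Require Import complex ring lra zify.

Import Order.TTheory GRing.Theory Num.Theory.

Local Open Scope ring_scope.

(** If [v] is a common right eigenvector then, in dimension two, the row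
    [w = (v_1, - v_0)] is a common left eigenvector, real or not.  Hence
    [w *m T_(k-1) ... T_0 a] is [w *m a] times a product of [k] left
    eigenvalues, which takes at most [k + 1] values.  As [w != 0], the vectors
    of R^2 with a given value of [w *m x] lie on one line, and a line contains
    at most two extreme points of a convex set; so there are at most
    [2 (k + 1)] extreme points. *)

Section ExtremePoints.
Local Open Scope classical_set_scope.
Context {R : realType} {E : lmodType R}.
Implicit Types (A C : set E) (x y z : E).

(** Removing an extreme point from a convex set leaves it convex. If [x] were outside [A], the hull
    without [x] would be a convex set containing [A], hence would contain the whole hull. *)
Lemma extreme_points_conv_hull A : extreme_points (conv_hull A) `<=` A.
Proof.
move=> x [hx ext]; apply: contrapT => nAx.
suff /(_ x hx)[_ /(_ erefl)] :
    conv_hull A `<=` [set y | conv_hull A y /\ y <> x] by [].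
apply: smallest_sub; last first.
  by move=> y Ay; split; [exact: sub_gen_smallest|move=> yx; apply: nAx; rewrite -yx].
apply/convex_setW => y z /[!inE] -[Cy yx] [Cz zx] t t0 t1.
rewrite inE; split.
  move=> X [cX AX].
  have := cX y z t; rewrite !inE; apply; [exact: Cy|exact: Cz].
by move=> /esym /(ext y z t%:num Cy Cz); rewrite t0 t1 => /(_ isT)[/yx].
Qed.

Lemma convex_combD x u v (t : R) :
  t *: (x + u) + (1 - t) *: (x + v) = x + (t *: u + (1 - t) *: v).
Proof. by rewrite !scalerDr addrACA -scalerDl subrKC scale1r. Qed.

(** Of three distinct collinear points one lies strictly between the other two: [x] if [s < 0],
    [x + s *: d] if [0 < s < 1], and [x + d] if [s > 1]. *)
Lemma extreme_points_line C x d (s : R) : d != 0 ->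
  extreme_points C x -> extreme_points C (x + d) ->
  extreme_points C (x + s *: d) -> s = 0 \/ s = 1.
Proof.
move=> d0 [Cx ex] [Cy ey] [Cz ez].
have [s0|s0|->] := ltgtP s 0; last by left.
- have s1 : 0 < 1 - s by lra.
  (* The weight solves [t + (1 - t) * s = 0]. *)
  have [] := ex (x + d) (x + s *: d) (- s / (1 - s)) Cy Cz.
  + by rewrite divr_gt0 ?oppr_gt0//= ltr_pdivrMr//; lra.
  + rewrite convex_combD scalerA -scalerDl.
    have -> : - s / (1 - s) + (1 - - s / (1 - s)) * s = 0 by field; lra.
    by rewrite scale0r addr0.
  + by move/eqP; rewrite -subr_eq0 addrC addKr (negbTE d0).
- have [s1|s1|->] := ltgtP s 1; last by right.
  + have [] := ez (x + d) (x + 0) s Cy; rewrite ?addr0//; first by rewrite s0.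
      by rewrite -[X in (1 - s) *: X]addr0 convex_combD scaler0 addr0.
    move=> _ /eqP; rewrite eq_sym -subr_eq0 addrC addKr scaler_eq0 (negbTE d0).
    by rewrite orbF => /eqP; left.
  + have [] := ey (x + s *: d) (x + 0) s^-1 Cz; rewrite ?addr0//.
    * by rewrite invr_gt0 s0 invf_lt1.
    * rewrite -[X in (1 - _) *: X]addr0 convex_combD scaler0 addr0.
      by rewrite scalerA mulVf ?scale1r// gt_eqF.
    * by move=> _ /eqP; rewrite eq_sym -subr_eq0 addrC addKr (negbTE d0).
Qed.

End ExtremePoints.

(** Induction on [cs], discarding from [s] the fiber over its head. Repetitions in [cs] only weaken
    the bound. *)
Lemma size_le_fibers (T U : eqType) (f : T -> U) (m : nat) (s : seq T)
    (cs : seq U) :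
  {in s, forall x, f x \in cs} ->
  (forall c, count (fun x => f x == c) s <= m)%N ->
  (size s <= m * size cs)%N.
Proof.
elim: cs s => [|c cs IH] s fs cnt.
  by case: s fs {cnt} => // x s /(_ x (mem_head _ _)).
rewrite -(count_predC (fun x => f x == c)) mulnS leq_add//.
rewrite -size_filter; apply: IH => [x|c'].
  rewrite mem_filter /= => /andP[/negbTE fxc] /fs.
  by rewrite in_cons fxc.
apply: leq_trans (cnt c').
by rewrite count_filter; apply: sub_count => x /andP[].
Qed.

(** Finite subsets suffice: an infinite [A] would contain one with more than [n] elements. *)
Lemma counting_le {T : choiceType} {R : realType} (A : set T) (n : nat) :
  (forall B : {fset T}, ([set` B] `<=` A)%classic -> (#|` B| <= n)%N) ->
  (counting A <= (n%:R : R)%:E)%E.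
Proof.
move=> H; rewrite /counting; case: asboolP => finA.
  rewrite lee_fin ler_nat; apply: H => x /=.
  by rewrite in_fset_set// inE.
have [B /H] := infinite_set_fset n.+1 finA.
by move=> /leq_ltn_trans h /h; rewrite ltnn.
Qed.

Lemma prod_two_values (K : comPzRingType) (p q : K) k (h : 'I_k -> K) :
  (forall j, h j = p \/ h j = q) ->
  \prod_(j < k) h j \in [seq p ^+ i * q ^+ (k - i) | i <- iota 0 k.+1].
Proof.
move=> H; suff [i ik ->] : exists2 i, (i <= k)%N &
    \prod_(j < k) h j = p ^+ i * q ^+ (k - i).
  by apply/mapP; exists i => //; rewrite mem_iota.
elim: k h H => [|k IH] h H; first by exists 0%N => //; rewrite big_ord0 mulr1.
rewrite big_ord_recl.
have [//|i ik ->] := IH (fun j => h (lift ord0 j)).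
have [->|->] := H ord0.
  by exists i.+1; rewrite ?ltnS// subSS exprS mulrA.
by exists i; rewrite 1?leqW// subSn// exprS mulrCA.
Qed.

Lemma sum2E (V : nmodType) (F : 'I_2 -> V) : \sum_(i < 2) F i = F 0 + F 1.
Proof.
rewrite !big_ord_recl big_ord0 addr0; congr (_ + F _); exact: val_inj.
Qed.

Lemma ord2P (i : 'I_2) : i = 0 \/ i = 1.
Proof. by case: i => -[|[|//]] ?; [left|right]; exact: val_inj. Qed.

Section LeftEigenvector.
Context {R : realType}.
Local Notation toC := (real_complex R).

Lemma left_eigenvector_prod n k (M : 'I_k -> 'M[R]_n) (w : 'rV[R[i]]_n) mu :
  (forall j, w *m map_mx toC (M j) = mu j *: w) ->
  w *m map_mx toC (\prod_(j < k) M j) = (\prod_(j < k) mu j) *: w.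
Proof.
elim: k M mu => [|k IH] M mu H.
  by rewrite !big_ord0 map_mx1 mulmx1 scale1r.
rewrite !big_ord_recl -mulmxE map_mxM mulmxA H -scalemxAl.
by rewrite (IH _ (fun j => mu (lift ord0 j)))// scalerA.
Qed.

Definition perp (v : 'cV[R[i]]_2) : 'rV[R[i]]_2 :=
  \row_j (if j == 0 then v 1 0 else - v 0 0).

Lemma perp_neq0 v : v != 0 -> perp v != 0.
Proof.
apply: contraNneq => /rowP pv; apply/eqP/colP => i; rewrite mxE.
move: (pv 0) (pv 1); rewrite !mxE /= => v1 /eqP; rewrite oppr_eq0 => /eqP v0.
have [->|->] := ord2P i.
  by [].
by [].
Qed.

(* [perp v *m A] is, up to this rotation, [\adj A *m v], and
   [\adj A = \tr A - A]; hence the eigenvalue [\tr A - lambda]. *)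
Lemma perp_left_eigenvector (A : 'M[R]_2) v : is_eigenvector A v ->
  exists mu, perp v *m map_mx toC A = mu *: perp v.
Proof.
move=> [_ [l /colP Av]]; exists (toC (\tr A) - l).
have := Av 0; have := Av 1; rewrite !mxE !sum2E !mxE => e1 e0.
have e : toC (\tr A) = toC (A 0 0) + toC (A 1 1) by rewrite /mxtrace sum2E rmorphD.
apply/rowP => j; rewrite e !mxE sum2E !mxE /=.
have [->|->] := ord2P j.
  by rewrite /= mulrBl -e1; ring.
by rewrite /= mulrBl !mulrN -e0; ring.
Qed.

(** The kernel of [w] is a complex line, so the determinant of [d] and [e] vanishes; its entries
    being real, the ratio is real too. *)
Lemma real_kernel_line (w : 'rV[R[i]]_2) (d e : 'cV[R]_2) :
  w != 0 -> d != 0 -> w *m map_mx toC d = 0 -> w *m map_mx toC e = 0 ->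
  exists s, e = s *: d.
Proof.
move=> w0 d0 /matrixP/(_ 0 0); rewrite !mxE sum2E !mxE => wd.
move=> /matrixP/(_ 0 0); rewrite !mxE sum2E !mxE => we.
have det : d 0 0 * e 1 0 = e 0 0 * d 1 0.
  apply: (@complexI R); rewrite !rmorphM /=.
  have [w00|w00] := eqVneq (w 0 0) 0; last first.
    (* Eliminating [w 0 1] from the two kernel equations leaves [w 0 0] times the determinant; the
       other case eliminates [w 0 0]. *)
    apply: (mulfI w00); apply/eqP; rewrite -subr_eq0; apply/eqP.
    rewrite -[RHS](subrr 0) -[X in _ = X - _](mul0r (toC (e 1 0))) -{1}wd.
    by rewrite -[X in _ = _ - X](mul0r (toC (d 1 0))) -we; ring.
  have w01 : w 0 1 != 0.
    apply: contra_neq w0 => w01; apply/rowP => j; rewrite mxE.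
    by have [->|->] := ord2P j.
  apply: (mulfI w01); apply/eqP; rewrite -subr_eq0; apply/eqP.
  rewrite -[RHS](subrr 0) -[X in _ = X - _](mul0r (toC (d 0 0))) -{1}we.
  by rewrite -[X in _ = _ - X](mul0r (toC (e 0 0))) -wd; ring.
have [d00|d00] := eqVneq (d 0 0) 0.
  have d10 : d 1 0 != 0.
    apply: contra_neq d0 => d10; apply/colP => j; rewrite mxE.
    by have [->|->] := ord2P j.
  exists (e 1 0 / d 1 0); apply/colP => j; rewrite mxE.
  have [->|->] := ord2P j; last by rewrite divfK.
  by apply: (mulIf d10); rewrite -det d00 mul0r mulr0 mul0r.
exists (e 0 0 / d 0 0); apply/colP => j; rewrite mxE.
have [->|->] := ord2P j; first by rewrite divfK.
by apply: (mulfI d00); rewrite det mulrA [d 0 0 * _]mulrC divfK.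
Qed.

Lemma extreme_points_fiber (C : set 'cV[R]_2) (w : 'rV[R[i]]_2)
    (s : seq 'cV[R]_2) c : w != 0 -> uniq s ->
  {in s, forall x, extreme_points C x} ->
  (count (fun x => w *m map_mx toC x == c) s <= 2)%N.
Proof.
move=> w0 us es; rewrite -size_filter.
have := filter_uniq (fun x => w *m map_mx toC x == c) us.
have : {in [seq x <- s | w *m map_mx toC x == c], forall x,
    extreme_points C x /\ w *m map_mx toC x = c}.
  by move=> x; rewrite mem_filter => /andP[/eqP wx /es].
case: [seq x <- s | _] => [|x [|y [|z r]]]// H.
have [ex wx] := H x (mem_head _ _).
have [ey wy] : extreme_points C y /\ w *m map_mx toC y = c.
  by apply: H; rewrite !inE eqxx orbT.
have [ez wz] : extreme_points C z /\ w *m map_mx toC z = c.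
  by apply: H; rewrite !inE eqxx !orbT.
rewrite /= !inE !negb_or => /andP[/and3P[xy xz _] /andP[/andP[yz _] _]].
have yx0 : y - x != 0 by rewrite subr_eq0 eq_sym.
(* Differences of points in one fiber are killed by [w], so [x], [y], [z] are collinear. *)
have [s' es'] : exists s', z - x = s' *: (y - x).
  by apply: (real_kernel_line _ _ _ w0); rewrite // map_mxB mulmxBr ?wx ?wy ?wz subrr.
case: (extreme_points_line C x (y - x) s' yx0 ex).
- by rewrite subrKC.
- by rewrite -es' subrKC.
- by move=> s0; move: es' xz; rewrite s0 scale0r => /subr0_eq ->; rewrite eqxx.
- by move=> s1; move: es' yz; rewrite s1 scale1r => /addIr ->; rewrite eqxx.
Qed.

Lemma N_le k (Sigma : {fset 'M[R]_2}) : #|` Sigma|%fset = 2%N ->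
  share_eigenvector Sigma -> (N_ k Sigma <= (2 * k.+1)%:R%:E)%E.
Proof.
move=> S2 [v vS].
have [A [B AB]] : exists A B, forall M, M \in Sigma -> M = A \/ M = B.
  case E : (enum_fset Sigma) S2 => [|A [|B []]]// _.
  exists A, B => M; rewrite -[M \in _]/(M \in enum_fset Sigma) E !inE.
  by move=> /orP[]/eqP; [left|right].
(* That [v] is nonzero is only known through a member of [Sigma], so one is extracted from the
   cardinality. *)
have v0 : v != 0.
  case E : (enum_fset Sigma) S2 => [|M ?]// _.
  suff /vS[] : M \in Sigma by [].
  by rewrite -[M \in _]/(M \in enum_fset Sigma) E mem_head.
(* Choice needs a value at every matrix; outside [Sigma] it is a dummy 0. *)
have muS M : exists mu, M \in Sigma -> perp v *m map_mx toC M = mu *: perp v.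
  have [/vS/(perp_left_eigenvector _ _)[mu]|_] := boolP (M \in Sigma); last by exists 0.
  by exists mu.
have [mu muP] := choice muS.
apply: ge_ereal_sup => _ [a _ <-]; apply: counting_le => X XP.
(* All candidate values of [perp v] on the product points, indexed by how often [A] occurs, from 0
   to [k]. *)
pose cs := [seq c *: (perp v *m map_mx toC a)
           | c <- [seq mu A ^+ i * mu B ^+ (k - i) | i <- iota 0 k.+1]].
have -> : k.+1 = size cs by rewrite !size_map size_iota.
apply: (size_le_fibers _ _ (fun x => perp v *m map_mx toC x)) => [x xX|c].
  have [T [TS ->]] := extreme_points_conv_hull _ _ (XP x xX).
  rewrite map_mxM mulmxA (left_eigenvector_prod _ _ _ _ (fun j => mu (T (rev_ord j)))); last first.
    by move=> j; exact: muP.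
  rewrite -scalemxAl; apply: (map_f (fun c => c *: _)); apply: prod_two_values => j /=.
  by have [->|->] := AB _ (TS (rev_ord j)); [left|right].
apply: (extreme_points_fiber _ _ _ _ (perp_neq0 _ v0) (fset_uniq X)) => x xX.
exact: XP.
Qed.

(** Removes the absolute value in [ebigO]; the starting vector 0 serves as a witness. *)
Lemma N_ge0 k (Sigma : {fset 'M[R]_2}) : (0 <= N_ k Sigma)%E.
Proof.
apply: ereal_sup_ge; exists (N_at k Sigma 0); first by exists 0.
by rewrite /N_at /counting; case: ifP => _; rewrite ?leey ?lee_fin.
Qed.

End LeftEigenvector.

Theorem proposition6 (R : realType) (Sigma : {fset 'M[R]_2}) :
  #|` Sigma|%fset = 2%N ->
  share_eigenvector Sigma ->
  oligo_vertex Sigma /\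
  ebigO (fun k : nat => N_ k Sigma) (fun k : nat => k%:R).
Proof.
move=> S2 Sv.
(* For [k] at least 1, [2 * (k + 1)] is at most [4 * k]. *)
have N4 k : (0 < k)%N -> (N_ k Sigma <= (4 * k%:R)%:E)%E.
  move=> k0; apply: le_trans (N_le k _ S2 Sv) _.
  by rewrite lee_fin -natrM ler_nat; lia.
split.
  by exists 4, 1%N, 1; split=> // k k0; rewrite powRr1//; exact: N4.
exists 4; exists 1%N => // k /= k0.
by rewrite gee0_abs ?N_ge0// normr_nat; exact: N4.
Qed.
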